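(* Let $V$ be an $\ell$-dimensional vector space over a field $k$, and let $\mathcal{A}'$ be a free arrangement in $V$ with $\exp(\mathcal{A}')=(d_1,\dots,d_\ell)$, $d_1\le\cdots\le d_\ell$, and let $1\le p\le\ell$ be the multiplicity of the highest exponent, i.e. $$d_1\le d_2\le\cdots\le d_{\ell-p}<d_{\ell-p+1}=\cdots=d_\ell=:d.$$ Let $H_1,\dots,H_q$ be (linear) hyperplanes in $V$ with $H_i\notin\mathcal{A}'$ for $i=1,\dots,q$. Define $$\mathcal{A}''_j:=\{H\cap H_j\mid H\in\mathcal{A}'\}\qquad(j=1,\dots,q).$$ Assume that the following three conditions are satisfied: (1) $X:=H_1\cap\cdots\cap H_q$ is $q$-codimensional. (2) $X\not\subseteq\bigcup_{H\in\mathcal{A}'}H$. (3) $|\mathcal{A}'|-|\mathcal{A}''_j|=d$ for all $1\le j\le q$. Then $q\le p$ and $\mathcal{A}:=\mathcal{A}'\cup\{H_1,\dots,H_q\}$ is free with $\exp(\mathcal{A})=(d_1,\dots,d_{\ell-q},(d+1)^q)$, where $(d+1)^q$ means that $d+1$ appears $q$ times.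
   Context: An arrangement in $V$ is a finite set of linear hyperplanes in $V$. Let $S=S(V^* )$ be the symmetric algebra of $V^*$, let $\mathrm{Der}\,S$ be the module of $k$-linear derivations $S\to S$, and let $\alpha_H\in V^*$ be a defining linear form of a hyperplane $H$. For an arrangement $\mathcal{A}$ put $D(\mathcal{A})=\{\theta\in\mathrm{Der}\,S\mid \theta(\alpha_H)\in\alpha_HS\text{ for all }H\in\mathcal{A}\}$. $\mathcal{A}$ is free with exponents $\exp(\mathcal{A})=(d_1,\dots,d_\ell)$ (regarded as a multiset) if $D(\mathcal{A})$ is a free $S$-module with a homogeneous basis $\theta_1,\dots,\theta_\ell$ such that $\deg\theta_i=d_i$. Here $\theta$ is homogeneous of degree $d$ if $\theta(x)$ is homogeneous of polynomial degree $d$ (or zero) for every $x\in V^*$. *)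

(* Defs.v *)
From HB Require Import structures.
From mathcomp Require Import all_boot all_order all_algebra finmap.
From mathcomp Require Import mpoly.

Set Implicit Arguments.
Unset Strict Implicit.
Unset Printing Implicit Defensive.

Import GRing.Theory.
Local Open Scope ring_scope.

(* The symmetric algebra S(V^* ) in coordinates: 'X_i is the i-th element of the
   basis of V^* dual to [vbasis {:V}], so that S(V^* ) = k['X_0, ..., 'X_(l-1)]. *)
Notation symdual k V := {mpoly k[\dim {: V}]}.

Section Arrangements.
Variables (k : fieldType) (V : vectType k).
Local Notation S := (symdual k V).

(* The inclusion of V^* into S(V^* ). *)
Definition form_poly (alpha : 'Hom(V, k^o)) : S :=
  \sum_(i < \dim {: V}) (alpha (vbasis {: V})`_i : k) *: 'X_i.

Definition hyperplane (H : {vspace V}) : Prop := (\dim H).+1 = \dim {: V}.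

Definition arrangement (A : {fset {vspace V}}) : Prop :=
  forall H, H \in A -> hyperplane H.

Definition derivation (theta : {linear S -> S}) : Prop :=
  forall f g : S, theta (f * g) = theta f * g + f * theta g.

(* D(A); the linear forms [alpha] with [lker alpha = H] are exactly the defining
   forms of a hyperplane H.  They differ by nonzero scalars only, so asking the
   condition for one or for all of them is the same. *)
Definition log_derivation (A : {fset {vspace V}}) (theta : {linear S -> S}) :
    Prop :=
  derivation theta /\
  forall (H : {vspace V}) (alpha : 'Hom(V, k^o)), H \in A -> lker alpha = H ->
    exists g : S, theta (form_poly alpha) = form_poly alpha * g.

Definition homogeneous_der (d : nat) (theta : {linear S -> S}) : Prop :=
  forall alpha : 'Hom(V, k^o), theta (form_poly alpha) \is d.-homog.

(* [theta] is a basis of the S-module D(A), whose structure is pointwise. *)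
Definition log_basis (A : {fset {vspace V}}) (n : nat)
    (theta : 'I_n -> {linear S -> S}) : Prop :=
  [/\ forall i, log_derivation A (theta i),
      forall eta : {linear S -> S}, log_derivation A eta ->
        exists c : 'I_n -> S, forall f, eta f = \sum_(i < n) c i * theta i f
    & forall c : 'I_n -> S, (forall f, \sum_(i < n) c i * theta i f = 0) ->
        forall i, c i = 0].

(* The order of the entries of [e] is irrelevant, as the basis may be
   re-indexed. *)
Definition free_with_exponents (A : {fset {vspace V}}) (e : seq nat) : Prop :=
  size e = \dim {: V} /\
  exists theta : 'I_(\dim {: V}) -> {linear S -> S},
    log_basis A theta /\
    forall i : 'I_(\dim {: V}), homogeneous_der (nth 0%N e i) (theta i).

Definition restriction (A : {fset {vspace V}}) (H : {vspace V}) :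
    {fset {vspace V}} :=
  [fset (K :&: H)%VS | K in A]%fset.

End Arrangements.

(* Main.v *)
Require Import Defs.
From HB Require Import structures.
From mathcomp Require Import all_boot all_order all_algebra finmap.
From mathcomp Require Import mpoly.
From mathcomp Require Import fingroup perm ring.
From Stdlib Require Import Classical.

Set Implicit Arguments.
Unset Strict Implicit.
Unset Printing Implicit Defensive.

Import GRing.Theory.
Local Open Scope ring_scope.

(** Let [alpha] be a linear form defining one of the new hyperplanes [H].
Reducing modulo [alpha], Terao's polynomial [b] of the pair [(A', H)], which is
homogeneous of degree [#|A'| - #|A''| = d], divides [theta alpha] for every
[theta] in [D(A')] ([restriction_divisor]). The reason is local: if
[K_1, ..., K_m] are the members of [A'] through a fixed [X = K_i :&: H], their
forms are combinations [s_i x + t_i alpha] of [alpha] and of one of them, [x];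
all of them divide [alpha * theta x - x * theta alpha], so that modulo [alpha]
the power [x ^+ m] divides [x * theta alpha]. Comparing degrees, a basis
element of [D(A')] of degree less than [d] is already logarithmic along [H],
and one of degree [d] takes on [alpha] a constant multiple of [b] modulo
[alpha] ([log_derivation_value]).

If one of these constants is nonzero, say for [theta_i0], then subtracting
multiples of [theta_i0] makes all other basis elements logarithmic along [H],
and these together with [alpha * theta_i0] form a basis for the larger
arrangement ([log_basisU1]): one exponent [d] has become [d + 1].

The hyperplanes are added one after the other in this way. The constants
cannot all vanish because of a point [x] in the intersection of the [H_j] and
on no member of [A']. The [H_j] being independent, there is a vector [w] lying
in all of them except the current one; the derivation along [w], multiplied by
the defining polynomial of [A'], is logarithmic for the arrangement reached so
far, and its value on [alpha] is nonzero at [x] ([log_derivation_direction]).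
Hence some basis element has a value on [alpha] that is nonzero at [x]. Its
degree is [d]: the elements of smaller degree take values divisible by
[alpha], and those of degree [d + 1] vanish at [x], being combinations with
coefficients vanishing at [x]; this last property is carried along the
induction ([homogeneous_addition]). So every step consumes one of the [p]
exponents equal to [d], which gives both the exponents and [q <= p]
([iterated_addition]). *)

(** * Divisibility in an integral domain *)

Section Divisibility.
Variable R : idomainType.
Implicit Types a f g p : R.

Definition divides a f : Prop := exists h, f = a * h.

Definition prime_element p : Prop :=
  [/\ p != 0, ~ divides p 1
    & forall f g, divides p (f * g) -> divides p f \/ divides p g].

Lemma divides_refl a : divides a a.
Proof. by exists 1; rewrite mulr1. Qed.

Lemma divides_mulr a f g : divides a f -> divides a (f * g).
Proof. by case=> h ->; exists (h * g); rewrite mulrA. Qed.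

Lemma divides_mull a f g : divides a g -> divides a (f * g).
Proof. by rewrite mulrC; apply: divides_mulr. Qed.

Lemma divides_add a f g : divides a f -> divides a g -> divides a (f + g).
Proof. by case=> h -> [h' ->]; exists (h + h'); rewrite mulrDr. Qed.

Lemma divides_opp a f : divides a f -> divides a (- f).
Proof. by case=> h ->; exists (- h); rewrite mulrN. Qed.

Lemma prime_divides_prod p (I : eqType) (s : seq I) (F : I -> R) :
  prime_element p -> divides p (\prod_(i <- s) F i) ->
  exists2 i, i \in s & divides p (F i).
Proof.
case=> _ p1 pM; elim: s => [|i s IHs]; first by rewrite big_nil => /p1.
rewrite big_cons => /pM[pFi|/IHs[j js pFj]].
  by exists i; rewrite ?mem_head.
by exists j; rewrite // inE js orbT.
Qed.

Lemma prime_divides_exp p f m :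
  prime_element p -> divides p (f ^+ m) -> divides p f.
Proof.
case=> _ p1 pM; elim: m => [|m IHm]; first by rewrite expr0 => /p1.
by rewrite exprS => /pM[|/IHm].
Qed.

(** Each factor [p] of [p ^+ m] is cancelled in turn, as a prime not dividing
[f] must divide the cofactor of [g]. *)
Lemma prime_exp_Gauss p f g m : prime_element p -> ~ divides p f ->
  divides (p ^+ m) (f * g) -> divides (p ^+ m) g.
Proof.
case=> p0 _ pM pf; elim: m => [|m IHm] in g *.
  by move=> _; exists g; rewrite mul1r.
rewrite exprSr => -[t]; rewrite -mulrA => Efg.
have [|h Eg] := IHm g; first by exists (p * t).
suff [/pf //|[h' Eh]]: divides p f \/ divides p h.
  by exists h'; rewrite Eg Eh mulrA.
apply: pM; exists t; apply: (mulfI (expf_neq0 m p0)).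
by rewrite -Efg Eg; ring.
Qed.

(** Pairwise non-associated primes: the powers of those already treated form a
product prime to the next one. *)
Lemma divides_prod_primes (I : eqType) (s : seq I) (x : I -> R) (m : I -> nat) g :
    uniq s -> {in s, forall i, prime_element (x i)} ->
    {in s &, forall i j, divides (x i) (x j) -> i = j} ->
    {in s, forall i, divides (x i ^+ m i) g} ->
  divides (\prod_(i <- s) x i ^+ m i) g.
Proof.
elim: s => [|i s IHs] in g *; first by exists g; rewrite big_nil mul1r.
move=> /=/andP[is_ us] xP xI xg; have is0 := mem_head i s.
have [||||h Eg] := IHs g.
- exact: us.
- by move=> j js; apply: xP; rewrite inE js orbT.
- by move=> j j' js j's; apply: xI; rewrite inE ?js ?j's orbT.
- by move=> j js; apply: xg; rewrite inE js orbT.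
have [|||h' Eh] := @prime_exp_Gauss (x i) (\prod_(j <- s) x j ^+ m j) h (m i).
- exact: xP.
- move/(prime_divides_prod (xP i is0))=> [j js /(prime_divides_exp (xP i is0))].
  by move/xI=> ij; move: is_; rewrite ij ?js // inE js orbT.
- by rewrite -Eg; apply: xg.
by exists h'; rewrite big_cons Eg Eh; ring.
Qed.

Lemma exp_divides_prod (I : eqType) (s : seq I) (x : R) (F : I -> R) :
  {in s, forall i, divides x (F i)} -> divides (x ^+ size s) (\prod_(i <- s) F i).
Proof.
elim: s => [|i s IHs] xF; first by rewrite big_nil expr0; apply: divides_refl.
have [h Eh] := xF i (mem_head i s).
have [j js|h' Eh'] := IHs; first by apply: xF; rewrite inE js orbT.
by exists (h * h'); rewrite big_cons Eh Eh' /= exprS; ring.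
Qed.

End Divisibility.

(** * Homogeneous polynomials *)

Section Homogeneous.
Variables (n : nat) (k : idomainType).
Implicit Types f g : {mpoly k[n]}.

Lemma pihomog_mul d a f g : f \is d.-homog ->
  pihomog mdeg (d + a) (f * g) = f * pihomog mdeg a g.
Proof.
move=> fd; elim/mpolyind: g => [|c m g _ _ IHg]; first by rewrite mulr0 !raddf0 mulr0.
rewrite mulrDr !raddfD /= mulrDr IHg -scalerAr !linearZ /= -scalerAr pihomogX.
congr (_ *: _ + _).
have fXm : f * 'X_[m] \is (d + mdeg m).-homog by rewrite dhomogM // dhomogX.
case: eqP => [<-|/eqP ma]; first by rewrite pihomog_dE.
by rewrite (pihomog_ne0 _ fXm) ?mulr0 // eqn_add2l.
Qed.

Lemma pihomog_mul_lt d a f g : f \is d.-homog -> (a < d)%N ->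
  pihomog mdeg a (f * g) = 0.
Proof.
move=> fd ad; elim/mpolyind: g => [|c m g _ _ IHg]; first by rewrite mulr0 !raddf0.
rewrite mulrDr raddfD /= IHg addr0 -scalerAr linearZ /=.
have fXm : f * 'X_[m] \is (d + mdeg m).-homog by rewrite dhomogM // dhomogX.
by rewrite (pihomog_ne0 _ fXm) ?scaler0 // gtn_eqF // ltn_addr.
Qed.

(** A cofactor of a homogeneous polynomial in a homogeneous polynomial is its
own homogeneous component of the expected degree. *)
Lemma homog_cofactor d e f g :
    f != 0 -> f \is d.-homog -> f * g \is e.-homog ->
  ((e < d)%N -> g = 0) /\ g \is (e - d).-homog.
Proof.
move=> f0 fd fge.
have glt : (e < d)%N -> g = 0.
  move=> ed; apply: (mulfI f0).
  by rewrite mulr0 -(pihomog_dE fge) (pihomog_mul_lt _ fd).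
split=> //; case: (ltnP e d) => [/glt->|de]; first exact: rpred0.
suff <- : pihomog mdeg (e - d) g = g by apply: pihomogP.
by apply: (mulfI f0); rewrite -(pihomog_mul _ _ fd) subnKC // pihomog_dE.
Qed.

Lemma homog0_const f : f \is 0.-homog -> f = (f@_0%MM)%:MP.
Proof.
move/dhomogP=> f0; apply/mpolyP => m; rewrite mcoeffC.
case: (eqVneq 0%MM m) => [<-|m0]; first by rewrite mulr1.
rewrite mulr0; apply/eqP/negPn/negP; rewrite -mcoeff_msupp.
by move/f0/eqP; rewrite mdeg_eq0 eq_sym (negPf m0).
Qed.

Lemma prod_homog (I : Type) (s : seq I) (F : I -> {mpoly k[n]}) (m : I -> nat) :
  (forall i, F i \is 1.-homog) ->
  \prod_(i <- s) F i ^+ m i \is ((\sum_(i <- s) m i)%N).-homog.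
Proof.
move=> F1; apply: (big_rec2 (fun p e => p \is e.-homog)); first exact: dhomog1.
move=> i d p _ pd; apply: dhomogM => //.
by have := dhomogMn (m i) (F1 i); rewrite mul1n.
Qed.

End Homogeneous.

Lemma divides_scale (n : nat) (k : fieldType) (a f : {mpoly k[n]}) (c : k) :
  c != 0 -> divides a (c *: f) -> divides a f.
Proof.
move=> c0 [h Eh]; exists (c^-1 *: h).
by rewrite -scalerAr -Eh scalerA mulVf // scale1r.
Qed.

(** * Linear forms *)

Section LinearForms.
Variables (k : fieldType) (V : vectType k).
Local Notation S := (symdual k V).
Local Notation form := 'Hom(V, k^o).
Implicit Types (alpha beta gamma : form) (u v w : V) (f g : S).

Lemma form_unit alpha : alpha != 0 -> exists v, alpha v = 1.
Proof.
move=> alpha0; have [u au] : exists u, alpha u != 0.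
  apply: NNPP => nex; case/eqP: alpha0; apply/lfunP => u; rewrite lfunE /=.
  by apply/eqP/negPn/negP => au; apply: nex; exists u.
by exists ((alpha u)^-1 *: u); rewrite linearZ /= [_ *: _]mulVf.
Qed.

(** A form is determined by its kernel and its value at one further vector. *)
Lemma lker_le_scale alpha beta : (lker alpha <= lker beta)%VS ->
  exists c, beta = c *: alpha.
Proof.
move=> /subvP le_ab; have [a0|/form_unit[v av]] := eqVneq alpha 0.
  exists 0; rewrite scale0r; apply/lfunP => u; rewrite lfunE /=; apply/eqP.
  by rewrite -memv_ker le_ab // memv_ker a0 lfunE.
exists (beta v); apply/lfunP => u; rewrite lfunE /=.
have: u - (alpha u : k) *: v \in lker beta.
  by apply: le_ab; rewrite memv_ker linearB linearZ /= av [_ *: _]mulr1 subrr.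
rewrite memv_ker linearB linearZ /= subr_eq0 => /eqP ->.
exact: mulrC.
Qed.

Lemma lkerZ c alpha : c != 0 -> lker (c *: alpha) = lker alpha.
Proof.
by move=> c0; apply/vspaceP => u; rewrite !memv_ker lfunE /= scaler_eq0 (negPf c0).
Qed.

Lemma lker_le_eq alpha beta : beta != 0 -> (lker alpha <= lker beta)%VS ->
  lker beta = lker alpha.
Proof.
move=> + /lker_le_scale[c Eb]; rewrite Eb scaler_eq0 negb_or => /andP[c0 _].
exact: lkerZ.
Qed.

Lemma hyperplane_form_exists (H : {vspace V}) : hyperplane H ->
  exists alpha : form, lker alpha = H.
Proof.
move=> hypH; pose pi := daddv_pi (H^C)%VS H; pose w := vpick (H^C)%VS.
have capHC : (H^C :&: H = 0)%VS by rewrite capvC capv_compl.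
have w0 : w != 0.
  by rewrite vpick0 -dimv_eq0 dimv_compl -hypH subSnn.
have piw : pi w = w by rewrite daddv_pi_id ?memv_pick.
have piH u : u \in H -> pi u = 0.
  move=> uH; have := @daddv_pi_add _ _ (H^C)%VS H u capHC.
  rewrite addvC addv_complf memvf (daddv_pi_id _ uH) ?capv_compl //.
  by move=> /(_ isT) /(canRL (addrK u)); rewrite subrr.
have [i wi] : exists i, coord (vbasis {:V}) i w != 0.
  apply: NNPP => nex; case/eqP: w0; rewrite (coord_vbasis (memvf w)).
  apply: big1 => i _; have [->|wi] := eqVneq (coord (vbasis {:V}) i w) 0.
    by rewrite scale0r.
  by case: nex; exists i.
pose alpha : form := (linfun (coord (vbasis {:V}) i : V -> k^o) \o pi)%VF.
have aE u : alpha u = coord (vbasis {:V}) i (pi u) by rewrite comp_lfunE lfunE.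
exists alpha; apply/esym/eqP; rewrite eqEdim; apply/andP; split.
  by apply/subvP => u /piH piu; rewrite memv_ker aE piu linear0.
rewrite -ltnS hypH ltn_neqAle dimvS ?subvf // andbT.
apply: contra wi; rewrite (dimv_leqif_eq (subvf _)) => /eqP kerf.
have : w \in lker alpha by rewrite kerf memvf.
by rewrite memv_ker aE piw.
Qed.

Definition point v : 'I_(\dim {:V}) -> k := fun i => coord (vbasis {:V}) i v.

Lemma form_coord alpha v :
  alpha v = \sum_(i < \dim {:V}) (alpha (vbasis {:V})`_i : k) * point v i.
Proof.
rewrite {1}(coord_vbasis (memvf v)) raddf_sum /=; apply: eq_bigr => i _.
by rewrite linearZ; apply: mulrC.
Qed.

Lemma form_poly_eval alpha v : (form_poly alpha).@[point v] = alpha v.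
Proof.
rewrite form_coord /form_poly raddf_sum /=.
by apply: eq_bigr => i _; rewrite mevalZ mevalXU.
Qed.

Lemma form_poly_is_linear : linear (@form_poly k V).
Proof.
move=> c alpha beta; rewrite /form_poly scaler_sumr -big_split /=.
by apply: eq_bigr => i _; rewrite !lfunE /= lfunE scalerDl scalerA.
Qed.

HB.instance Definition _ :=
  GRing.isLinear.Build k form S _ (@form_poly k V) form_poly_is_linear.

Lemma form_poly_homog alpha : form_poly alpha \is 1.-homog.
Proof. by apply: rpred_sum => i _; rewrite rpredZ // dhomogX /= mdeg1. Qed.

Lemma form_poly_eq0 alpha : (form_poly alpha == 0) = (alpha == 0).
Proof.
apply/eqP/eqP => [a0|->]; last exact: raddf0.
by apply/lfunP => u; rewrite -form_poly_eval a0 meval0 lfunE.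
Qed.

Lemma divides_form_lker alpha beta :
  divides (form_poly alpha) (form_poly beta) -> (lker alpha <= lker beta)%VS.
Proof.
case=> h Eb; apply/subvP => u; rewrite !memv_ker -!form_poly_eval Eb mevalM.
by move=> /eqP ->; rewrite mul0r.
Qed.

(** The substitution pulling polynomial functions back along the linear map
[u |-> u - alpha u *: v]. When [alpha v = 1] this is the projection of [V] onto
[lker alpha] along [v]; its image is then a copy of the quotient of [S] by
[form_poly alpha] inside [S] itself. *)
Definition pullback alpha v f : S :=
  f \mPo [tuple 'X_i - point v i *: form_poly alpha | i < \dim {:V}].

HB.instance Definition _ alpha v := GRing.RMorphism.copy (pullback alpha v)
  (comp_mpoly [tuple 'X_i - point v i *: form_poly alpha | i < \dim {:V}]).

Lemma pullbackX alpha v i :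
  pullback alpha v 'X_i = 'X_i - point v i *: form_poly alpha.
Proof. by rewrite /pullback comp_mpolyXU -tnth_nth tnth_mktuple. Qed.

Lemma pullback_form alpha v beta :
  pullback alpha v (form_poly beta) = form_poly (beta - (beta v : k) *: alpha).
Proof.
rewrite raddfB /= linearZ /= form_coord scaler_suml.
rewrite {1 2}/form_poly raddf_sum -sumrB; apply: eq_bigr => i _.
by rewrite [LHS]comp_mpolyZ -/(pullback alpha v 'X_i) pullbackX scalerBr scalerA.
Qed.

Lemma pullback_homog alpha v d f : f \is d.-homog -> pullback alpha v f \is d.-homog.
Proof.
move/dhomogP=> fd; rewrite /pullback comp_mpolyEX big_seq; apply: rpred_sum => m /fd <-.
rewrite rpredZ // comp_mpolyX /= mdegE; apply: prod_homog => i.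
by rewrite tnth_mktuple rpredB ?dhomogX /= ?mdeg1 // rpredZ // form_poly_homog.
Qed.

(** It is enough to check the variables, since the set of all [f] with this
property contains the constants and is stable under sums and products. *)
Lemma pullback_congr alpha v f : divides (form_poly alpha) (f - pullback alpha v f).
Proof.
pose P (g : S) := divides (form_poly alpha) (g - pullback alpha v g).
have PM g h : P g -> P h -> P (g * h).
  move=> [a Ea] [b Eb]; exists (a * h + pullback alpha v g * b).
  by rewrite mulrDr mulrA -Ea mulrCA -Eb rmorphM /=; ring.
have PC c : P c%:MP by exists 0; rewrite [pullback _ _ _]comp_mpolyC subrr mulr0.
elim/mpolyind: f => [|c m f _ _ IHf]; first by rewrite -mpolyC0; apply: PC.
rewrite rmorphD opprD addrACA; apply: divides_add => //.
rewrite -mul_mpolyC; apply: (PM) => //; rewrite mpolyXE_id.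
apply: big_ind => //; first by rewrite -mpolyC1; apply: PC.
move=> i _; elim: (m i) => [|j IHj]; first by rewrite expr0 -mpolyC1; apply: PC.
rewrite exprS; apply: PM => //; exists (point v i)%:MP.
by rewrite pullbackX opprB addrC subrK mulrC mul_mpolyC.
Qed.

Lemma pullback_eq0 alpha v f : alpha v = 1 ->
  pullback alpha v f = 0 <-> divides (form_poly alpha) f.
Proof.
move=> av; split=> [f0|[h ->]]; last first.
  by rewrite rmorphM /= pullback_form av scale1r subrr raddf0 mul0r.
by have := pullback_congr alpha v f; rewrite f0 subr0.
Qed.

(** The ideal generated by the form is the kernel of a ring endomorphism of an
integral domain. *)
Lemma form_prime alpha : alpha != 0 -> prime_element (form_poly alpha).
Proof.
move=> a0; have [v av] := form_unit a0; split; first by rewrite form_poly_eq0.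
- by move/(pullback_eq0 _ av)/eqP; rewrite rmorph1 oner_eq0.
- move=> f g /(pullback_eq0 _ av)/eqP; rewrite rmorphM mulf_eq0.
  by case/orP=> /eqP /(pullback_eq0 _ av); [left|right].
Qed.

Lemma hyperplane_form_bool (H : {vspace V}) :
  exists alpha : form, ((\dim H).+1 == \dim {:V}) ==> (lker alpha == H).
Proof.
case: eqP => [/hyperplane_form_exists[alpha <-]|_]; last by exists 0.
by exists alpha; rewrite eqxx.
Qed.

Definition hyperplane_form (H : {vspace V}) : form :=
  xchoose (hyperplane_form_bool H).

Lemma lker_hyperplane_form H : hyperplane H -> lker (hyperplane_form H) = H.
Proof.
move=> hypH; apply/eqP.
by apply: (implyP (xchooseP (hyperplane_form_bool H))); apply/eqP.
Qed.

Lemma hyperplane_form_neq0 H : hyperplane H -> hyperplane_form H != 0.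
Proof.
move=> hypH; apply/eqP => H0; have := hypH; rewrite /hyperplane.
rewrite -(lker_hyperplane_form hypH) H0; have -> : lker (0 : form) = fullv.
  by apply/vspaceP => u; rewrite memvf memv_ker lfunE /= eqxx.
by move/eqP; rewrite eqn_leq ltnn.
Qed.

Lemma hyperplane_le_eq (H K : {vspace V}) : hyperplane H -> hyperplane K ->
  (H <= K)%VS -> H = K.
Proof.
move=> hypH hypK HK; apply/eqP; rewrite eqEdim HK /=.
by rewrite -ltnS hypH hypK.
Qed.

End LinearForms.

(** * The values of logarithmic derivations on a further hyperplane *)

Section RestrictionDivisor.
Variables (k : fieldType) (V : vectType k).
Local Notation S := (symdual k V).
Local Notation form := 'Hom(V, k^o).

Variables (A : {fset {vspace V}}) (arrA : arrangement A).
Variables (H : {vspace V}) (hypH : hyperplane H) (HA : H \notin A).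
Variables (alpha : form) (kerA : lker alpha = H) (v : V) (av : alpha v = 1).

Local Notation a := hyperplane_form.
Local Notation pi := (pullback alpha v).

(** The representative, killing [v], of the restriction to [H] of the form of
[K]; two of them are associated exactly when [K] and [K'] have the same trace
on [H]. *)
Definition restricted_form K : form := a K - (a K v : k) *: alpha.
Local Notation r := restricted_form.

Lemma restricted_formE K u : u \in H -> r K u = a K u.
Proof.
by rewrite -kerA memv_ker => /eqP au; rewrite !lfunE /= !lfunE /= !lfunE /= au scaler0 subr0.
Qed.

Lemma pullback_hyperplane_form K : pi (form_poly (a K)) = form_poly (r K).
Proof. exact: pullback_form. Qed.

Lemma not_sub_arrangement K : K \in A -> ~~ (H <= K)%VS.
Proof.
move=> KA; apply: contra HA => /(hyperplane_le_eq hypH (arrA KA)) ->; exact: KA.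
Qed.

Lemma mem_lker_r K u : hyperplane K -> u \in H -> (u \in lker (r K)) = (u \in K).
Proof.
move=> hypK uH; rewrite memv_ker restricted_formE // -memv_ker.
by rewrite lker_hyperplane_form.
Qed.

Lemma restricted_form_neq0 K : K \in A -> r K != 0.
Proof.
move=> KA; apply: contra (not_sub_arrangement KA) => /eqP rK.
apply/subvP => u uH; rewrite -(mem_lker_r (arrA KA) uH) rK.
by rewrite memv_ker lfunE.
Qed.

Lemma restricted_form_inj K K' : K \in A -> K' \in A ->
  divides (form_poly (r K)) (form_poly (r K')) -> (K :&: H = K' :&: H)%VS.
Proof.
move=> KA K'A /divides_form_lker /(lker_le_eq (restricted_form_neq0 K'A)) ker_eq.
apply/vspaceP => u; rewrite !memv_cap; case: (boolP (u \in H)); last by rewrite !andbF.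
move=> uH; rewrite !andbT; have := mem_lker_r (arrA K'A) uH.
by rewrite ker_eq (mem_lker_r (arrA KA) uH).
Qed.

(** Forms vanishing on a subspace of codimension two cut out by [a K0] and
[alpha] are combinations of these two. The coefficient [c] is nonzero because
otherwise [K] would be [H]. *)
Lemma form_poly_pencil K0 K : K0 \in A -> K \in A -> (K :&: H = K0 :&: H)%VS ->
  exists c t, c != 0 /\
    form_poly (a K) = c *: form_poly (a K0) + t *: form_poly alpha.
Proof.
move=> K0A KA KH; have /subvPn[w wH wK0] := not_sub_arrangement K0A.
have aw : alpha w = 0 by apply/eqP; rewrite -memv_ker kerA.
pose x := a K0; have xw : x w != 0.
  by rewrite -memv_ker lker_hyperplane_form //; apply: arrA.
pose c : k := a K w / x w; pose t : k := a K v - c * x v.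
have formB (f : form) u (b : k) u' : f (u - b *: u') = (f u : k) - b * (f u' : k) :> k.
  by rewrite linearB linearZ.
have solve (p au pv xu xv y pw : k) : y != 0 ->
    p - au * pv - (xu - au * xv) / y * pw = 0 ->
    p = pw / y * xu + (pv - pw / y * xv) * au.
  by move=> y0 E; rewrite -[LHS]subr0 -E; field.
have EK : a K = c *: x + t *: alpha.
  apply/lfunP => u; rewrite !lfunE /= !lfunE /=.
  (* [y] is the correction of [u] that lies in the kernels of [alpha] and [x]. *)
  pose z := u - (alpha u : k) *: v.
  pose y := z - ((x z : k) / x w : k) *: w.
  have yK : y \in K.
    suff: y \in (K0 :&: H)%VS by rewrite -KH memv_cap => /andP[].
    rewrite memv_cap -{1}(lker_hyperplane_form (arrA K0A)) -kerA !memv_ker.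
    apply/andP; split; apply/eqP; rewrite /y !formB; first by rewrite mulfVK // subrr.
    by rewrite av aw; ring.
  have := yK; rewrite -{1}(lker_hyperplane_form (arrA KA)) memv_ker /y /z !formB.
  move=> /eqP aKy; apply: solve aKy; exact: xw.
exists c, t; split; last by rewrite EK linearD !linearZ.
apply/eqP => c0.
case/negP: (not_sub_arrangement KA); rewrite -kerA -(lker_hyperplane_form (arrA KA)).
by apply/subvP => u; rewrite !memv_ker EK c0 scale0r add0r lfunE /= => /eqP ->; rewrite scaler0.
Qed.

(** With [x] the form of [K0], the polynomial [alpha * theta x - x * theta alpha]
is divisible by the forms of all [K] in the pencil [s], hence by their product.
Modulo [alpha], this product is [x ^+ size s] up to a constant, while the
polynomial is [- x * theta alpha]. *)
Lemma fiber_power (s : seq {vspace V}) K0 (theta : {linear S -> S}) :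
    uniq s -> {subset s <= A} -> K0 \in s ->
    {in s, forall K, K :&: H = K0 :&: H}%VS -> log_derivation A theta ->
  divides (form_poly (r K0) ^+ (size s).-1) (pi (theta (form_poly alpha))).
Proof.
move=> us sA K0s sH [_ logt].
pose x := form_poly (a K0); pose y := form_poly alpha.
pose F := y * theta x - x * theta y.
have aF : {in s, forall K, divides (form_poly (a K) ^+ 1) F}.
  move=> K Ks; rewrite expr1; have [c [t [c0 EaK]]] := form_poly_pencil (sA _ K0s) (sA _ Ks) (sH _ Ks).
  have [h Eh] := logt K (a K) (sA _ Ks) (lker_hyperplane_form (arrA (sA _ Ks))).
  have cF : c *: F = y * theta (form_poly (a K)) - form_poly (a K) * theta y.
    rewrite EaK -/x -/y [theta (_ + _)]linearD ![theta (_ *: _)]linearZ /= /F -!mul_mpolyC; ring.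
  apply: (divides_scale c0); rewrite cF; apply: divides_add.
    by apply: divides_mull; exists h.
  by apply: divides_opp; exists (theta y).
have [K Ks||h EF] := divides_prod_primes us _ _ aF.
- by apply: form_prime; apply/hyperplane_form_neq0/arrA/sA.
- move=> K K' Ks K's /divides_form_lker.
  rewrite !lker_hyperplane_form; [|exact/arrA/sA..].
  by apply: hyperplane_le_eq; apply/arrA/sA.
have piy : pi y = 0 by apply/(pullback_eq0 _ av)/divides_refl.
have [|h' Eh'] := @exp_divides_prod _ _ s (form_poly (r K0)) (fun K => pi (form_poly (a K))).
  move=> K Ks /=; have [c [t [c0 ->]]] := form_poly_pencil (sA _ K0s) (sA _ Ks) (sH _ Ks).
  rewrite -!mul_mpolyC rmorphD !rmorphM /= piy mulr0 addr0.
  by rewrite pullback_hyperplane_form; apply/divides_mull/divides_refl.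
have s_gt0 : (0 < size s)%N by case: (s) K0s.
(* One factor [r K0] is cancelled from both sides of the image of [EF]. *)
exists (- (h' * pi h)); apply: (mulfI (x := form_poly (r K0))).
  by rewrite form_poly_eq0 restricted_form_neq0 ?sA.
have := congr1 pi EF; rewrite rmorphB !rmorphM /= piy mul0r sub0r.
rewrite pullback_hyperplane_form rmorph_prod => /(canRL (@opprK _)) ->.
rewrite [in LHS](eq_bigr (fun K => pi (form_poly (a K)))); last by move=> K _; rewrite expr1.
by rewrite Eh' mulrA -exprS prednK //; ring.
Qed.

(** The fibers of [K |-> K :&: H] partition [A]. *)
Lemma sum_fiber_sizes :
  (\sum_(X <- restriction A H) (size [seq K <- A | (K :&: H)%VS == X]).-1)%N =
  (#|` A| - #|` restriction A H|)%N.
Proof.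
pose fib X := size [seq K <- A | (K :&: H)%VS == X].
have fib_gt0 X : X \in restriction A H -> (0 < fib X)%N.
  case/imfsetP=> K /= KA ->; rewrite /fib size_filter -has_count.
  by apply/hasP; exists K.
rewrite (eq_bigr (fun X => fib X - 1)%N); last by move=> X _; rewrite subn1.
rewrite big_seq sumnB // -!big_seq sum1_size; congr (_ - _)%N.
rewrite -[RHS]sum1_size; under eq_bigr => X _ do rewrite /fib size_filter -sum1_count big_mkcond.
rewrite exchange_big /= big_seq [RHS]big_seq; apply: eq_bigr => K KA.
have KHr : (K :&: H)%VS \in restriction A H by apply/imfsetP; exists K.
rewrite (bigD1_seq _ KHr) ?fset_uniq //= eqxx big1 ?addn0 // => X.
by rewrite eq_sym => /negPf ->.
Qed.

(** This is Terao's polynomial [b]: for each [X] in the restriction it collects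
all but one of the hyperplanes [K] with [K :&: H = X], read modulo [alpha]. *)
Lemma restriction_divisor : exists b : S,
  [/\ b \is (#|` A| - #|` restriction A H|).-homog, ~ divides (form_poly alpha) b
    & forall theta, log_derivation A theta ->
        divides b (pi (theta (form_poly alpha)))].
Proof.
pose fib X := [seq K <- A | (K :&: H)%VS == X].
pose rep X := head 0%VS (fib X).
have repP X : X \in restriction A H -> rep X \in fib X.
  case/imfsetP=> K /= KA EX; rewrite /rep.
  have: K \in fib X by rewrite mem_filter KA EX eqxx.
  by case: (fib X) => //= K' s _; apply: mem_head.
have repA X : X \in restriction A H -> rep X \in A.
  by move/repP; rewrite mem_filter => /andP[].
have repH X : X \in restriction A H -> (rep X :&: H)%VS = X.
  by move/repP; rewrite mem_filter => /andP[/eqP].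
have a0 : alpha != 0.
  by apply/eqP => a0; move/eqP: av; rewrite a0 lfunE eq_sym oner_eq0.
exists (\prod_(X <- restriction A H) form_poly (r (rep X)) ^+ (size (fib X)).-1).
split.
- rewrite -sum_fiber_sizes; apply: prod_homog => X; exact: form_poly_homog.
- move/(prime_divides_prod (form_prime a0))=> [X XA].
  move/(prime_divides_exp (form_prime a0))/divides_form_lker/lker_le_scale => [c Er].
  case/eqP: (restricted_form_neq0 (repA X XA)); rewrite Er.
  have := congr1 (fun f : form => f v) Er.
  rewrite !lfunE /= !lfunE /= !lfunE /= av [_ *: 1]mulr1 subrr [_ *: 1]mulr1 => <-.
  exact: scale0r.
move=> theta logt; apply: divides_prod_primes.
- exact: fset_uniq.
- by move=> X XA; apply/form_prime/restricted_form_neq0/repA.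
- move=> X X' XA X'A /restricted_form_inj -/(_ (repA X XA) (repA X' X'A)).
  by rewrite !repH.
move=> X XA; apply: fiber_power logt.
- by rewrite filter_uniq // fset_uniq.
- by move=> K; rewrite mem_filter => /andP[].
- exact: repP.
by move=> K; rewrite mem_filter repH // => /andP[/eqP].
Qed.

(** Used in two cases: if [e] is less than the degree of [b] then [theta] is
logarithmic along [H], and if the two are equal then [g] is a constant. *)
Lemma log_derivation_value : exists b : S,
  [/\ b != 0, b \is (#|` A| - #|` restriction A H|).-homog, ~ divides (form_poly alpha) b
    & forall theta e, log_derivation A theta -> homogeneous_der e theta ->
      exists g h, [/\ theta (form_poly alpha) = b * g + form_poly alpha * h,
        (e < #|` A| - #|` restriction A H|)%N -> g = 0
        & g \is (e - (#|` A| - #|` restriction A H|)).-homog]].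
Proof.
have [b [bd ab bP]] := restriction_divisor.
have b0 : b != 0 by apply/eqP => b0; apply: ab; rewrite b0; exists 0; rewrite mulr0.
exists b; split=> // theta e logt te; have [g Eg] := bP _ logt.
have [h Eh] := pullback_congr alpha v (theta (form_poly alpha)).
have [glt ge] : ((e < #|` A| - #|` restriction A H|)%N -> g = 0) /\
    g \is (e - (#|` A| - #|` restriction A H|)).-homog.
  by apply: homog_cofactor b0 bd _; rewrite -Eg pullback_homog.
by exists g, h; split=> //; rewrite -Eg -Eh addrC subrK.
Qed.

End RestrictionDivisor.

(** * Logarithmic derivations and bases *)

Section Derivations.
Variables (k : fieldType) (V : vectType k).
Local Notation S := (symdual k V).
Local Notation form := 'Hom(V, k^o).
Implicit Types (theta eta : {linear S -> S}) (A : {fset {vspace V}}).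

(** Forms with the same kernel are proportional, so that one defining form of a
hyperplane is enough to test whether a derivation is logarithmic along it. *)
Lemma divides_on_lker theta (alpha beta : form) : lker alpha = lker beta ->
  divides (form_poly alpha) (theta (form_poly alpha)) ->
  divides (form_poly beta) (theta (form_poly beta)).
Proof.
move=> ker_eq [h Eh].
have [|c Eb] := @lker_le_scale _ _ alpha beta; first by rewrite ker_eq subvv.
have Efb : form_poly beta = c *: form_poly alpha by rewrite Eb linearZ.
by exists h; rewrite Efb linearZ /= Eh scalerAl.
Qed.

Lemma log_derivationU1 A theta (alpha : form) :
  log_derivation (lker alpha |` A)%fset theta <->
  log_derivation A theta /\ divides (form_poly alpha) (theta (form_poly alpha)).
Proof.
split=> [[dert logt]|[[dert logt] ta]].
  split; last by apply: (logt (lker alpha)) => //; rewrite fset1U1.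
  by split=> // K beta KA; apply: logt; rewrite fset1Ur.
split=> // K beta /fset1UP[-> /esym kab|]; last exact: logt.
exact: divides_on_lker ta.
Qed.

Lemma log_derivation_mul A theta (f : S) :
  log_derivation A theta -> log_derivation A (f \*o theta).
Proof.
move=> [dert logt]; split=> [g h /=|K alpha KA kerK /=].
  by rewrite dert; ring.
by have [h ->] := logt K alpha KA kerK; exists (f * h); ring.
Qed.

Lemma log_derivation_sub A theta eta :
  log_derivation A theta -> log_derivation A eta ->
  log_derivation A (theta \- eta).
Proof.
move=> [dert logt] [dere loge]; split=> [g h /=|K alpha KA kerK /=].
  by rewrite dert dere; ring.
have [h ->] := logt K alpha KA kerK; have [h' ->] := loge K alpha KA kerK.
by exists (h - h'); ring.
Qed.

Lemma log_basis_perm A n (theta : 'I_n -> {linear S -> S}) (s : 'S_n) :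
  log_basis A theta -> log_basis A (theta \o s).
Proof.
move=> [logt gen indep]; split=> [i|eta loge|c c0 i]; first exact: logt.
  have [c Ec] := gen eta loge; exists (c \o s) => f.
  by rewrite Ec (reindex_inj (@perm_inj _ s)).
rewrite -[i](permK s); apply: (indep (c \o (s^-1)%g)) => f.
rewrite -[RHS](c0 f) (reindex_inj (@perm_inj _ s)).
by apply: eq_bigr => j _ /=; rewrite permK.
Qed.

Definition directional (w : V) (f : S) : S :=
  \sum_(i < \dim {:V}) point w i *: f^`M(i).

Lemma directional_is_linear w : linear (directional w).
Proof.
move=> c f g; rewrite /directional scaler_sumr -big_split /=.
by apply: eq_bigr => i _; rewrite mderivD mderivZ scalerDr !scalerA mulrC.
Qed.

HB.instance Definition _ w :=
  GRing.isLinear.Build k S S _ (directional w) (directional_is_linear w).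

Lemma directional_derivation w : derivation (directional w).
Proof.
move=> f g; rewrite /directional mulr_suml mulr_sumr -big_split /=.
by apply: eq_bigr => i _; rewrite mderivM scalerDr scalerAl scalerAr.
Qed.

Lemma mderiv_form (alpha : form) i :
  (form_poly alpha)^`M(i) = (alpha (vbasis {:V})`_i : k)%:MP.
Proof.
rewrite /form_poly raddf_sum /= (bigD1 i) //= big1 => [|j ji].
  by rewrite addr0 mderivZ mderivX mnm1E eqxx scale1r -{1}[U_(i)%MM]add0m addmK mpolyX0 -mul_mpolyC mulr1.
by rewrite mderivZ mderivX mnm1E (negPf ji) scale0r scaler0.
Qed.

Lemma directional_form w (alpha : form) :
  directional w (form_poly alpha) = (alpha w : k)%:MP.
Proof.
rewrite form_coord [RHS]raddf_sum; apply: eq_bigr => i _.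
by rewrite mderiv_form /= mpolyCM -mul_mpolyC mulrC.
Qed.

(** * Adding one hyperplane *)

(** Intended for the situation where, modulo [alpha], the value of [theta i] on
[alpha] is [g i] times that of [theta i0]. *)
Definition added_basis n (theta : 'I_n -> {linear S -> S}) (alpha : form)
    (g : 'I_n -> S) (i0 : 'I_n) (i : 'I_n) : {linear S -> S} :=
  if i == i0 then (form_poly alpha \*o theta i0 : {linear S -> S})
  else (theta i \- (g i \*o theta i0) : {linear S -> S}).

(** The element [alpha * theta i0] suffices: if [\sum_i c i * theta i] is
logarithmic along [lker alpha], then [alpha] divides [b * \sum_i c i * g i], hence
the sum [\sum_i c i * g i], which is the coefficient of [theta i0] once
[eta] is written with the modified elements. *)
Lemma log_basisU1 A n (theta : 'I_n -> {linear S -> S}) (alpha : form)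
    (b : S) (g h : 'I_n -> S) (i0 : 'I_n) :
    log_basis A theta -> alpha != 0 -> ~ divides (form_poly alpha) b ->
    (forall i, theta i (form_poly alpha) = b * g i + form_poly alpha * h i) ->
    g i0 = 1 ->
  log_basis (lker alpha |` A)%fset (added_basis theta alpha g i0).
Proof.
move=> [logt gen indep] a0 ab Eg gi0; rewrite /added_basis.
split=> [i|eta /log_derivationU1[loge [t Et]]|c c0].
- apply/log_derivationU1; case: eqP => _; split.
  + exact: log_derivation_mul.
  + by exists (theta i0 (form_poly alpha)).
  + by apply: log_derivation_sub => //; apply: log_derivation_mul.
  + by exists (h i - g i * h i0); rewrite /= !Eg gi0; ring.
- have [c Ec] := gen eta loge; pose cc := \sum_(i < n) c i * g i.
  have [r Er] : divides (form_poly alpha) cc.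
    have [_ _ aM] := form_prime a0.
    suff /aM[//|/ab] : divides (form_poly alpha) (cc * b) by [].
    exists (t - \sum_(i < n) c i * h i); rewrite mulrBr -Et Ec mulr_sumr -sumrB.
    by rewrite mulr_suml; apply: eq_bigr => i _; rewrite Eg; ring.
  exists (fun i => if i == i0 then r else c i) => f.
  have -> : eta f = cc * theta i0 f + \sum_(i < n | i != i0) c i * (theta i f - g i * theta i0 f).
    rewrite Ec /cc (bigD1 i0) //= [in RHS](bigD1 i0) //= gi0 mulr1 mulrDl -addrA.
    by rewrite mulr_suml -big_split /=; congr (_ + _); apply: eq_bigr => i _; ring.
  rewrite [RHS](bigD1 i0) //= eqxx /= Er; congr (_ + _); first by ring.
  by apply: eq_bigr => i /negPf ->.
(* The coefficients with respect to the original basis. *)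
pose c' i := if i == i0 then c i0 * form_poly alpha - \sum_(j < n | j != i0) c j * g j else c i.
have c'0 i : c' i = 0.
  apply: indep => f; rewrite -[RHS](c0 f) (bigD1 i0) //= [RHS](bigD1 i0) //= /c' eqxx /=.
  rewrite mulrBl -addrA mulr_suml -sumrN -big_split /=; congr (_ + _); first by ring.
  by apply: eq_bigr => j /negPf ->; rewrite /=; ring.
have cN i : i != i0 -> c i = 0 by move=> /negPf ii0; have := c'0 i; rewrite /c' ii0.
move=> i; have [->|/cN //] := eqVneq i i0.
have := c'0 i0; rewrite /c' eqxx big1 ?subr0; last by move=> j /cN ->; rewrite mul0r.
by move/eqP; rewrite mulf_eq0 form_poly_eq0 (negPf a0) orbF => /eqP.
Qed.

End Derivations.

(** * Adding the hyperplanes one at a time *)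

Section Addition.
Variables (k : fieldType) (V : vectType k).
Local Notation S := (symdual k V).
Local Notation form := 'Hom(V, k^o).
Variables (A' : {fset {vspace V}}) (arrA' : arrangement A').

Lemma log_derivation_subset (A B : {fset {vspace V}}) (theta : {linear S -> S}) :
  {subset A <= B} -> log_derivation B theta -> log_derivation A theta.
Proof. by move=> AB [dert logt]; split=> // K beta /AB; apply: logt. Qed.

(** The derivation along [w] kills the forms of the hyperplanes containing [w].
Multiplied by the defining polynomial of [A'], which is nonzero at [x], it
becomes logarithmic along the members of [A'] as well. *)
Lemma log_derivation_direction (A : {fset {vspace V}}) (x w : V) :
    {in A', forall K : {vspace V}, x \notin K} ->
    {in A, forall K : {vspace V}, K \in A' \/ w \in K} ->
  exists2 eta : {linear S -> S}, log_derivation A eta &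
    forall alpha : form, alpha w != 0 -> (eta (form_poly alpha)).@[point x] != 0.
Proof.
move=> xA' wA; pose Q := \prod_(K <- A') form_poly (hyperplane_form K).
exists (Q \*o directional w : {linear S -> S}).
  split=> [f g /=|K beta KA kerK /=]; first by rewrite directional_derivation; ring.
  rewrite directional_form; case: (wA K KA) => [KA'|wK]; last first.
    move: wK; rewrite -kerK memv_ker => /eqP ->.
    by exists 0; rewrite mpolyC0 !mulr0.
  have [|c Eb] := @lker_le_scale _ _ beta (hyperplane_form K).
    by rewrite kerK lker_hyperplane_form ?subvv //; apply: arrA'.
  have -> : Q = form_poly beta *
      (c *: \prod_(K' <- A' | K' != K) form_poly (hyperplane_form K')).
    by rewrite /Q (bigD1_seq K) ?fset_uniq //= Eb linearZ /= -scalerAl -scalerAr.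
  by rewrite -mulrA; apply/divides_mulr/divides_refl.
move=> alpha aw; rewrite /= directional_form mevalM mevalC mulf_neq0 //.
rewrite /Q rmorph_prod prodf_seq_neq0; apply/allP => K KA' /=.
rewrite form_poly_eval; apply: contra (xA' K KA') => /eqP aKx.
by rewrite -(lker_hyperplane_form (arrA' KA')) memv_ker; apply/eqP.
Qed.

(** The derivation [eta] forces some [theta i0] to have a value on the new form
that is nonzero at [x]. Its degree is at most [d] because the elements of higher
degree vanish at [x], and at least [d] because otherwise [g i0 = 0]; so [g i0] is
a nonzero constant. That elements of degree more than [d] vanish at [x] is
assumed and established again, in order that the step can be repeated. *)
Lemma homogeneous_addition (A : {fset {vspace V}}) (H : {vspace V}) (x : V) n
    (theta : 'I_n -> {linear S -> S}) (deg : 'I_n -> nat) (d : nat) :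
    {subset A' <= A} -> hyperplane H -> H \notin A' ->
    (#|` A'| - #|` restriction A' H|)%N = d -> x \in H ->
    log_basis A theta -> (forall i, homogeneous_der (deg i) (theta i)) ->
    (forall i, (d < deg i)%N -> forall beta : form,
       (theta i (form_poly beta)).@[point x] = 0) ->
    (exists2 eta : {linear S -> S}, log_derivation A eta &
       forall alpha : form, lker alpha = H -> (eta (form_poly alpha)).@[point x] != 0) ->
  exists i0, deg i0 = d /\
  let deg' i := if i == i0 then d.+1 else deg i in
  exists theta' : 'I_n -> {linear S -> S},
    [/\ log_basis (H |` A)%fset theta', forall i, homogeneous_der (deg' i) (theta' i)
      & forall i, (d < deg' i)%N -> forall beta : form,
          (theta' i (form_poly beta)).@[point x] = 0].
Proof.
move=> subA hypH HA' card_d xH basis_t hom_t van_t [eta loge eta_x].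
have [logt gen _] := basis_t.
pose alpha := hyperplane_form H; have kera : lker alpha = H := lker_hyperplane_form hypH.
have a0 : alpha != 0 := hyperplane_form_neq0 hypH.
have ax : alpha x = 0 by apply/eqP; rewrite -memv_ker kera.
have [v av] := form_unit a0.
have [b] := log_derivation_value arrA' hypH HA' kera av.
rewrite card_d => -[b0 bd ab bP].
have /fin_all_exists[g /fin_all_exists[h gh]] i := bP _ _ (log_derivation_subset subA (logt i)) (hom_t i).
have val_x i : (theta i (form_poly alpha)).@[point x] = b.@[point x] * (g i).@[point x].
  have [-> _ _] := gh i.
  by rewrite mevalD !mevalM form_poly_eval ax mul0r addr0.
have [i0 i0x] : exists i0, (theta i0 (form_poly alpha)).@[point x] != 0.
  apply: NNPP => nex; case/eqP: (eta_x alpha kera).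
  have [c ->] := gen eta loge; rewrite rmorph_sum big1 //= => i _; rewrite mevalM.
  have [->|ix] := eqVneq (theta i (form_poly alpha)).@[point x] 0; first by rewrite mulr0.
  by case: nex; exists i.
have [bx gx] : b.@[point x] != 0 /\ (g i0).@[point x] != 0.
  by apply/andP; rewrite -negb_or -mulf_eq0 -val_x.
have g0 : g i0 != 0 by apply: contraNneq gx => ->; rewrite meval0.
have deg0 : deg i0 = d.
  apply/eqP; rewrite eqn_leq; apply/andP; split; rewrite leqNgt.
    by apply: contra i0x => /van_t ->.
  by apply: contra g0 => lt_d; have [_ /(_ lt_d) -> _] := gh i0.
have [c Ec] : exists c, g i0 = c%:MP.
  have [_ _] := gh i0; rewrite deg0 subnn => /homog0_const Eg.
  by exists ((g i0)@_0%MM).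
have c0 : c != 0 by move: gx; rewrite Ec mevalC.
exists i0; split=> // deg'.
(* Moving the constant into [b] makes the cofactor of [theta i0] equal to 1. *)
pose g' i := c^-1 *: g i.
exists (added_basis theta alpha g' i0); split.
- rewrite -kera; apply: (@log_basisU1 _ _ _ _ _ _ (c *: b) g' h) => //.
  + by move=> abc; apply: ab; apply: divides_scale c0 abc.
  + move=> i; have [-> _ _] := gh i; congr (_ + _).
    by rewrite /g' -scalerAl -scalerAr scalerA mulfV // scale1r.
  + by rewrite /g' Ec -mul_mpolyC -mpolyCM mulVf.
- move=> i beta; rewrite /deg' /added_basis; case: eqP => _ /=.
    by rewrite -add1n -deg0 dhomogM ?form_poly_homog //; apply: hom_t.
  rewrite rpredB //; first exact: hom_t.
  have [_ glt ge] := gh i; rewrite /g' -scalerAl rpredZ //.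
  have [/glt ->|le_d] := ltnP (deg i) d; first by rewrite mul0r rpred0.
  rewrite -(subnK le_d) dhomogM // -deg0; exact: hom_t.
move=> i; rewrite /deg' /added_basis; case: eqP => _ lt_d beta /=.
  by rewrite mevalM form_poly_eval ax mul0r.
rewrite mevalB mevalM (van_t i lt_d) sub0r mevalZ.
suff -> : (g i).@[point x] = 0 by rewrite mulr0 mul0r oppr0.
by apply: (mulfI bx); rewrite -val_x (van_t i lt_d) mulr0.
Qed.

End Addition.

(** * Exponents and independent hyperplanes *)

Lemma free_with_exponents_perm (k : fieldType) (V : vectType k)
    (A : {fset {vspace V}}) (theta : 'I_(\dim {:V}) -> {linear symdual k V -> symdual k V})
    (deg : 'I_(\dim {:V}) -> nat) (e : seq nat) :
    log_basis A theta -> (forall i, homogeneous_der (deg i) (theta i)) ->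
    perm_eq [seq deg i | i <- enum 'I_(\dim {:V})] e ->
  free_with_exponents A e.
Proof.
move=> basis_t hom_t perm_e.
have size_e : size e == \dim {:V}.
  by rewrite -(perm_size perm_e) size_map size_enum_ord.
have [s Es] : exists s : 'S_(\dim {:V}), e = [seq deg (s i) | i <- enum 'I_(\dim {:V})].
  have: perm_eq (Tuple size_e) [tuple deg i | i < \dim {:V}] by rewrite perm_sym.
  case/tuple_permP=> s Es; exists s; rewrite -[LHS]/(tval (Tuple size_e)) Es.
  by apply: eq_map => i; rewrite tnth_mktuple.
split; first exact/eqP.
exists (theta \o s); split; first exact: log_basis_perm.
by move=> i; rewrite Es (nth_map i) ?size_enum_ord // nth_ord_enum; apply: hom_t.
Qed.

Lemma perm_map_change (T : finType) (f : T -> nat) (i0 : T) (c : nat) (s : seq nat) :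
    perm_eq [seq f i | i <- enum T] (rcons s (f i0)) ->
  perm_eq [seq (if i == i0 then c else f i) | i <- enum T] (c :: s).
Proof.
have enum_i0 : perm_eq (enum T) (i0 :: rem i0 (enum T)).
  by apply: perm_to_rem; rewrite mem_enum.
move=> perm_f; apply: perm_trans (perm_map _ enum_i0) _; rewrite /= eqxx perm_cons.
have: perm_eq (f i0 :: [seq f i | i <- rem i0 (enum T)]) (f i0 :: s).
  by rewrite -map_cons -(permPl (perm_map f enum_i0)) (permPl perm_f) perm_rcons.
rewrite perm_cons => /(perm_trans _); apply; rewrite (eq_in_map _ f _).1 // => i.
by rewrite mem_rem_uniq ?enum_uniq // !inE => /andP[/negPf -> _].
Qed.

(** Both subspaces lie in [V], whose dimension is that of [H] plus one. *)
Lemma dim_hyperplane_cap (k : fieldType) (V : vectType k) (H U : {vspace V}) :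
  hyperplane H -> (\dim U <= (\dim (H :&: U)).+1)%N.
Proof.
move=> hypH; have := dimv_sum_cap H U.
have := dimvS (subvf (H + U)%VS); rewrite -hypH => le_sum Esum.
by rewrite -(leq_add2l (\dim H)) -Esum -addSnnS leq_add2r.
Qed.

Lemma dim_bigcap_hyperplanes (k : fieldType) (V : vectType k) (I : Type)
    (s : seq I) (P : pred I) (H : I -> {vspace V}) :
    (forall i, hyperplane (H i)) ->
  (\dim {:V} <= \dim (\bigcap_(i <- s | P i) H i)%VS + count P s)%N.
Proof.
move=> hypH; elim: s => [|i s IHs]; first by rewrite big_nil addn0.
rewrite big_cons /=; case: (P i) => //=.
by apply: (leq_trans IHs); rewrite addnCA add1n -addSn leq_add2r dim_hyperplane_cap.
Qed.

(** Each hyperplane lowers the dimension of an intersection by at most one;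
as [q] hyperplanes lower it by [q], none of them can be omitted. *)
Lemma independent_direction (k : fieldType) (V : vectType k) (q : nat)
    (H : 'I_q -> {vspace V}) (j0 : 'I_q) :
    (forall j, hyperplane (H j)) ->
    (\dim (\bigcap_(j < q) H j)%VS + q)%N = \dim {:V} ->
  exists2 w, w \notin H j0 & forall j, j != j0 -> w \in H j.
Proof.
move=> hypH codim; pose U := (\bigcap_(j < q | j != j0) H j)%VS.
have /subvPn[w wU wH] : ~~ (U <= H j0)%VS.
  apply/negP => /capv_idPr capU.
  have := dim_bigcap_hyperplanes (index_enum 'I_q) (fun j => j != j0) hypH.
  rewrite -codim (bigD1 j0) //= -/U capU leq_add2l -sum1_count.
  rewrite -[X in (X <= _)%N]card_ord -sum1_card (bigD1 j0) //= add1n.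
  by rewrite ltnn.
exists w => // j jj0; apply: (subvP _ w wU).
by rewrite /U (bigD1 j jj0) /= capvSl.
Qed.

(** The induction over the added hyperplanes. An element of degree [d] is
consumed at every step; while the current exponents are those of
[take (\dim {:V} - size s) e] and copies of [d + 1], such an element exists only
if [size s < p], and it may be taken to be the last entry of that prefix. *)
Lemma iterated_addition (k : fieldType) (V : vectType k)
    (A' : {fset {vspace V}}) (arrA' : arrangement A')
    (e : seq nat) (freeA' : free_with_exponents A' e)
    (p d : nat) (p_le : (p <= \dim {:V})%N)
    (e_low : forall i, (i < \dim {:V} - p)%N -> (nth 0%N e i < d)%N)
    (e_high : forall i, (\dim {:V} - p <= i < \dim {:V})%N -> nth 0%N e i = d)
    (q : nat) (H : 'I_q -> {vspace V})
    (hypH : forall j, hyperplane (H j))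
    (HnotinA' : forall j, H j \notin A')
    (codimX : (\dim (\bigcap_(j < q) H j)%VS + q)%N = \dim {:V})
    (x : V) (xX : x \in (\bigcap_(j < q) H j)%VS)
    (xA' : forall K, K \in A' -> x \notin K)
    (card_restr : forall j, (#|` A'| - #|` restriction A' (H j)|)%N = d)
    (s : seq 'I_q) : uniq s ->
  (size s <= p)%N /\
  exists (theta : 'I_(\dim {:V}) -> {linear symdual k V -> symdual k V})
         (deg : 'I_(\dim {:V}) -> nat),
  [/\ log_basis (A' `|` [fset H j | j in s])%fset theta,
      forall i, homogeneous_der (deg i) (theta i),
      perm_eq [seq deg i | i <- enum 'I_(\dim {:V})]
        (take (\dim {:V} - size s) e ++ nseq (size s) d.+1)
    & forall i, (d < deg i)%N -> forall beta : 'Hom(V, k^o),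
        (theta i (form_poly beta)).@[point x] = 0].
Proof.
have [size_e [theta0 [basis0 hom0]]] := freeA'.
have e_le i : (nth 0%N e i <= d)%N.
  have [lt_i|le_i] := ltnP i (\dim {:V} - p); first exact/ltnW/e_low.
  have [lt_l|le_l] := ltnP i (\dim {:V}); first by rewrite e_high ?le_i.
  by rewrite nth_default ?size_e.
elim: s => [_|j s IHs /= /andP[js us]].
  split=> //; exists theta0, (fun i => nth 0%N e i); split=> //.
  - by have -> : (A' `|` [fset H j | j in [::]] = A')%fset
      by apply/fsetP => K; rewrite in_fsetU; case: imfsetP => [[]|] //; rewrite orbF.
  - rewrite subn0 cats0 take_oversize ?size_e //.
    by rewrite -[X in perm_eq _ X](mkseq_nth 0%N) /mkseq size_e -val_enum_ord -map_comp.
  by move=> i; rewrite ltnNge e_le.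
have [le_p [theta [deg [basis_t hom_t perm_t van_t]]]] := IHs us.
set A := (A' `|` _)%fset in basis_t.
have xH : x \in H j.
  by apply: (subvP _ x xX); rewrite (bigD1 j) //= capvSl.
have [w wHj wH] := independent_direction j hypH codimX.
have [|eta loge eta_x] := @log_derivation_direction _ _ _ arrA' A x w xA'.
  move=> K; rewrite in_fsetU => /orP[|/imfsetP[i /= si ->]]; first by left.
  by right; apply: wH; apply: contraNneq js => <-.
have subA : {subset A' <= A} by move=> K KA; rewrite in_fsetU KA.
have [|i0 [deg0 [theta' [basis' hom' van']]]] := homogeneous_addition arrA' subA
    (hypH j) (HnotinA' j) (card_restr j) xH basis_t hom_t van_t.
  exists eta => // alpha kera; apply: eta_x.
  by apply: contra wHj => /eqP aw; rewrite -kera memv_ker; apply/eqP.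
(* For [size s = p] only exponents below [d] and equal to [d + 1] are left. *)
have lt_p : (size s < p)%N.
  rewrite ltn_neqAle le_p andbT; apply/eqP => size_s.
  have: d \in [seq deg i | i <- enum 'I_(\dim {:V})].
    by rewrite -deg0 map_f ?mem_enum.
  rewrite (perm_mem perm_t) mem_cat mem_nseq => /orP[|/andP[_]]; last first.
    by rewrite -[d in d == _]addn0 -addn1 eqn_add2l.
  case/(nthP 0%N)=> i; rewrite size_take size_e size_s => lt_i.
  have {}lt_i : (i < \dim {:V} - p)%N by apply: leq_trans lt_i _; case: ltnP.
  by rewrite nth_take // => Ed; have := e_low i lt_i; rewrite Ed ltnn.
split=> //.
have -> : (A' `|` [fset H i | i in j :: s])%fset = (H j |` A)%fset.
  apply/fsetP => K; rewrite in_fset1U !in_fsetU; apply/idP/idP.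
    case/orP=> [->|/imfsetP[i /= + ->]]; first by rewrite orbT.
    rewrite inE => /orP[/eqP ->|si]; first by rewrite eqxx.
    by apply/orP; right; apply/orP; right; apply/imfsetP; exists i.
  case/orP=> [/eqP ->|/orP[->//|/imfsetP[i /= si ->]]]; apply/orP; right; apply/imfsetP.
    by exists j; rewrite //= mem_head.
  by exists i; rewrite //= inE si orbT.
exists theta', (fun i => if i == i0 then d.+1 else deg i); split=> //.
pose m := (\dim {:V} - (size s).+1)%N.
have Em : (\dim {:V} - size s)%N = m.+1.
  by rewrite /m subnS prednK // subn_gt0; apply: leq_trans p_le.
have Ed : nth 0%N e m = d.
  by apply: e_high; rewrite leq_sub2l //= -Em leq_subr.
have Etake : take (\dim {:V} - size s) e = rcons (take m e) d.
  by rewrite Em (take_nth 0%N) ?Ed // size_e -Em leq_subr.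
rewrite -/m /= -cat_rcons.
apply: perm_trans (perm_map_change (s := take m e ++ nseq (size s) d.+1) _ _) _.
  rewrite deg0; apply: perm_trans perm_t _; rewrite Etake cat_rcons perm_sym.
  by rewrite perm_rcons perm_sym -cat1s perm_catCA.
by rewrite cat_rcons perm_sym -[d.+1 :: nseq _ _]cat1s perm_catCA.
Qed.

(** * The multiple addition theorem *)

Theorem theorem3p1 (k : fieldType) (V : vectType k) (l : nat)
    (dimV : \dim {: V} = l)
    (A' : {fset {vspace V}}) (arrA' : arrangement A')
    (e : seq nat) (freeA' : free_with_exponents A' e) (e_sorted : sorted leq e)
    (p d : nat) (p_bounds : (1 <= p <= l)%N)
    (e_low : forall i, (i < l - p)%N -> (nth 0%N e i < d)%N)
    (e_high : forall i, (l - p <= i < l)%N -> nth 0%N e i = d)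
    (q : nat) (H : 'I_q -> {vspace V})
    (hypH : forall j, hyperplane (H j))
    (HnotinA' : forall j, H j \notin A')
    (codimX : (\dim (\bigcap_(j < q) H j)%VS + q)%N = l)
    (X_not_covered : ~ (forall v : V, v \in (\bigcap_(j < q) H j)%VS ->
                          exists2 K, K \in A' & v \in K))
    (card_restr : forall j, (#|` A'| - #|` restriction A' (H j)|)%N = d) :
  (q <= p)%N /\
  free_with_exponents (A' `|` [fset H j | j in 'I_q])%fset
    (take (l - q) e ++ nseq q d.+1).
Proof.
subst l; case/andP: p_bounds => _ p_le.
have [x xX xA'] : exists2 x, x \in (\bigcap_(j < q) H j)%VS &
    forall K, K \in A' -> x \notin K.
  apply: NNPP => nex; apply: X_not_covered => x xX; apply: NNPP => nK.
  by case: nex; exists x => // K KA'; apply/negP => xK; apply: nK; exists K.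
have [] := iterated_addition arrA' freeA' p_le e_low e_high hypH HnotinA' codimX
  xX xA' card_restr (enum_uniq 'I_q).
rewrite size_enum_ord => le_q [theta [deg [basis_t hom_t perm_t _]]]; split=> //.
apply: free_with_exponents_perm perm_t => //.
have <- // : (A' `|` [fset H j | j in enum 'I_q] = A' `|` [fset H j | j in 'I_q])%fset.
congr (_ `|` _)%fset; apply/fsetP => K.
by apply/imfsetP/imfsetP => -[j _ ->]; exists j; rewrite //= mem_enum.
Qed.
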